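(* Let $n\ge 2$, $d\ge 1$, and $p\in\mathcal H(n,d)$. Then $$ d\le\frac{2n\,(2N(p)-3)}{3n^2-3n-2}\le\frac{4}{3}\cdot\frac{2N(p)-3}{2n-3}. $$
   Context: $\mathcal H(n,d)$ is the set of real polynomials in $x_1,\dots,x_n$ of total degree exactly $d$, with all coefficients nonnegative, such that $p(x)=1$ whenever $\sum_{j=1}^n x_j=1$. $N(p)$ denotes the number of distinct monomials occurring with nonzero coefficient in $p$. *)

(* Defs.v *)
From mathcomp Require Import all_boot all_order all_algebra.
From mathcomp Require Import reals.
From mathcomp Require Import mpoly.
Set Implicit Arguments. Unset Strict Implicit. Unset Printing Implicit Defensive.
Import Order.TTheory GRing.Theory Num.Theory.
Local Open Scope ring_scope.

(* H(n,d): real polynomials in x_1..x_n of total degree exactly d,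
   all coefficients nonnegative, with p(x) = 1 whenever sum_j x_j = 1.
   msize p = 1 + total degree (msize 0 = 0). *)
Definition inH (R : realType) (n d : nat) (p : {mpoly R[n]}) : Prop :=
  [/\ msize p = d.+1,
      (forall m : 'X_{1..n}, 0 <= p@_m)
    & forall x : 'I_n -> R, \sum_(j < n) x j = 1 -> p.@[x] = 1].

Definition Nmon (R : realType) (n : nat) (p : {mpoly R[n]}) : nat :=
  size (msupp p).

(* Main.v *)
Require Import Defs.
From mathcomp Require Import all_boot all_order all_algebra.
From mathcomp Require Import reals.
From mathcomp Require Import mpoly.
From mathcomp Require Import ring lra zify.
Set Implicit Arguments. Unset Strict Implicit. Unset Printing Implicit Defensive.
Import Order.TTheory GRing.Theory Num.Theory.
Local Open Scope ring_scope.

(** For [n = 2], write [P - 1 = (x + y - 1) q] and let [q_k], [P_k] be the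
    homogeneous parts of degree [k], so that [q_(k+1) = (x + y) q_k - P_(k+1)].
    At [(1, -t)] the factor [x + y] becomes [1 - t], and multiplying
    by it creates a new sign change in the coefficients, as in Descartes' rule,
    while subtracting a monomial destroys at most two. Positivity keeps [q_k]
    nonzero below the top degree [D], and [(x + y) q_(D-1) = P_D] has fewer
    sign changes than monomials; counting gives [D <= 2 N - 3].

    For [n = r + 2], substitute for [x_1, ..., x_n] the [n] monomials of a
    bivariate polynomial of degree [2 r + 1] that equals 1 on [x + y = 1] (built
    from a Lucas polynomial). The number of monomials does not increase, and
    averaging over the cyclic shifts of the substitution multiplies the degree
    by at least the mean degree [(3 n^2 - 3 n - 2) / (2 n)] of the monomials. *)

(** * Sign changes in sequences and polynomial coefficients *)

(* Zeros are skipped, so [k] indices witness [k - 1] sign changes; [e] is the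
   sign at the first of them. *)
Fixpoint alternates {R : realDomainType} (f : nat -> R) (e : bool)
    (l k : nat) : Prop :=
  if k is k'.+1 then
    exists i, [/\ (l <= i)%N, 0 < (-1) ^+ e * f i
                & alternates f (~~ e) i.+1 k']
  else True.

Section Alternation.
Variable R : realDomainType.
Implicit Types (f g : nat -> R) (p q : {poly R}) (e : bool).

Lemma alternates_weaken f e l l' k :
  (l' <= l)%N -> alternates f e l k -> alternates f e l' k.
Proof.
case: k => //= k le_l [i [li fi alt]]; exists i; split=> //.
exact: leq_trans li.
Qed.

Lemma eq_alternates f g e l k :
  (forall i, (l <= i)%N -> f i = g i) -> alternates f e l k ->
  alternates g e l k.
Proof.
elim: k e l => //= k IH e l fg [i [li fi alt]].
exists i; split=> //; first by rewrite -fg.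
by apply: IH alt => j ij; apply/fg/ltnW/(leq_ltn_trans li).
Qed.

(** If [b] is one of the chosen indices, dropping it together with the next one leaves the signs
    alternating. *)
Lemma alternates_update f g b e l k :
  (forall i, i != b -> f i = g i) -> alternates f e l k.+2 ->
  alternates g e l k.
Proof.
move=> fg; elim: k e l => // k IH e l [i [li fi alt]].
have [ib|i_b] := eqVneq i b; last first.
  by exists i; split; rewrite -?fg //; apply: IH.
case: alt => j [ij _]; rewrite negbK => alt.
apply: (@alternates_weaken _ _ j.+1); first lia.
by apply: (@eq_alternates f g e j.+1 k.+1) alt => m jm; apply/fg; lia.
Qed.

Lemma alternates_count f e l k (s : seq nat) :
  (forall i, f i != 0 -> i \in s) -> alternates f e l k ->
  (k <= count (leq l) s)%N.
Proof.
move=> fs; elim: k e l => //= k IH e l [i [li fi alt]].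
apply: leq_ltn_trans (IH _ _ alt) _.
have si : i \in s.
  by apply: fs; apply: contraTneq fi => ->; rewrite mulr0 ltxx.
have -> : count (leq l) s
    = (count (leq i.+1) s + count (fun j => (l <= j) && (j <= i)) s)%N.
  rewrite -count_predUI [X in (_ + X)%N](@eq_count _ _ pred0).
    by rewrite count_pred0 addn0; apply: eq_count => j /=; lia.
  by move=> j /=; lia.
rewrite -[ltnLHS]addn0 ltn_add2l -has_count; apply/hasP; exists i => //.
by rewrite li leqnn.
Qed.

Lemma telescope_pos (h : nat -> R) l i :
  (l <= i)%N -> h l < h i ->
  exists j, [/\ (l <= j)%N, (j < i)%N & 0 < h j.+1 - h j].
Proof.
elim: i => [|i IH]; first by rewrite leqn0 => /eqP ->; rewrite ltxx.
rewrite leq_eqVlt => /orP[/eqP <-|li]; first by rewrite ltxx.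
move=> hli; have [le_i|lt_i] := lerP (h i.+1) (h i).
  have [j [lj ji hj]] := IH li (lt_le_trans hli le_i).
  by exists j; split=> //; apply: ltnW.
by exists i; split=> //; rewrite subr_gt0.
Qed.

(* [h] is the sequence of coefficients of [X * q], so that those of
   [(1 - X) * q] are its forward differences. *)
Lemma alternates_diff (h : nat -> R) n e l k :
  (forall i, (n <= i)%N -> h i = 0) ->
  (-1) ^+ e * h l <= 0 -> (k = 0%N -> (-1) ^+ e * h l < 0) ->
  alternates (fun i => h i.+1) e l k ->
  alternates (fun i => h i.+1 - h i) e l k.+1.
Proof.
move=> h0; elim: k e l => [|k IH] e l hl hl0 alt.
  (* With no term left, the signed [h] must still climb from a negative value to its eventual value
     0, and that climb gives the extra term. *)
  have [//||i [li _ hi]] := @telescope_pos (fun i => (-1) ^+ e * h i) l (maxn l n).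
  - exact: leq_maxl.
  - by rewrite [h (maxn _ _)]h0 ?leq_maxr // mulr0 hl0.
  by exists i; split=> //; rewrite mulrBr.
case: alt => i [li hi alt].
have [||j [lj ji hj]] := @telescope_pos (fun i => (-1) ^+ e * h i) l i.+1.
- exact: leqW.
- exact: le_lt_trans hi.
have neg : (-1) ^+ (~~ e) * h i.+1 < 0.
  by rewrite signrN mulNr oppr_lt0.
exists j; split=> //; first by rewrite mulrBr.
apply: (@alternates_weaken _ _ i.+1) => //.
by apply: IH alt; rewrite ?ltW.
Qed.

Lemma alternates_mul1BX q e k :
  (0 < k)%N -> alternates (nth 0 q) e 0 k ->
  alternates (nth 0 ((1 - 'X) * q)) e 0 k.+1.
Proof.
move=> k0 alt.
pose h i := ('X * q)`_i.
have hS i : h i.+1 = q`_i by rewrite /h coefXM.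
apply: (@eq_alternates (fun i => h i.+1 - h i)).
  by move=> i _; rewrite hS mulrBl mul1r coefB.
apply: (@alternates_diff _ (size ('X * q))).
- by move=> i; apply: nth_default.
- by rewrite /h coefXM mulr0.
- by move=> k_0; rewrite k_0 in k0.
- by apply: eq_alternates alt => i _; rewrite hS.
Qed.

Lemma alternates_sub_monomials (I : Type) (r : seq I) (P : pred I)
    (v : I -> R) (b : I -> nat) q e l k :
  alternates (nth 0 q) e l (k + 2 * count P r) ->
  alternates (nth 0 (q - \sum_(i <- r | P i) v i *: 'X^(b i))) e l k.
Proof.
elim: r q => [|i r IH] q; first by rewrite big_nil subr0 muln0 addn0.
rewrite big_cons /=; case: (P i); last exact: IH.
rewrite opprD addrA mulnDr muln1 addnCA => alt.
apply/IH/(@alternates_update _ _ (b i))/alt => j jb.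
by rewrite coefB coefZ coefXn (negPf jb) mulr0 subr0.
Qed.

Lemma alternates1 q : q != 0 -> exists e, alternates (nth 0 q) e 0 1.
Proof.
rewrite -lead_coef_eq0 => q0; exists (lead_coef q < 0), (size q).-1.
by split=> //; rewrite -normrEsign normr_gt0.
Qed.

End Alternation.

(** * The degree bound in two variables *)

Section Bivariate.
Variables (R : realFieldType) (I : eqType) (r : seq I).
Variables (c : I -> R) (a b : I -> nat).
Hypothesis c_gt0 : forall i, i \in r -> 0 < c i.
Hypothesis sum1 : forall x y : R, x + y = 1 ->
  \sum_(i <- r) c i * x ^+ a i * y ^+ b i = 1.

Let deg i := (a i + b i)%N.

(* The homogeneous part of degree [k] of [q] (see the header) at [(1, - X)]. *)
Definition residual k : {poly R} :=
  (1 - 'X) ^+ k - \sum_(i <- r | (deg i <= k)%N)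
    (c i * (-1) ^+ b i) *: 'X^(b i) * (1 - 'X) ^+ (k - deg i).

Lemma residualS k :
  residual k.+1 = (1 - 'X) * residual k
    - \sum_(i <- r | deg i == k.+1) (c i * (-1) ^+ b i) *: 'X^(b i).
Proof.
rewrite /residual (bigID (fun i => deg i == k.+1)) /= mulrBr -exprS opprD.
rewrite addrA -[in RHS]addrA -opprD [in RHS]addrC -addrA -opprD [in RHS]addrC.
congr (_ - _); rewrite addrC mulr_sumr; congr (_ + _).
  rewrite (eq_bigl (fun i => deg i <= k)%N); last by move=> i; lia.
  by apply: eq_bigr => i ik; rewrite subSn // exprS mulrCA.
rewrite (eq_bigl (fun i => deg i == k.+1)); last by move=> i; lia.
by apply: eq_bigr => i /eqP->; rewrite subnn mulr1.
Qed.

(** Scaling [(1, -t)] by [(1 - t)^-1] puts it on the line [x + y = 1], where the terms of degree at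
    most [k] sum to 1 minus the others. *)
Lemma horner_residual k t : t != 1 ->
  (residual k).[t] = (1 - t) ^+ k *
    \sum_(i <- r | (k < deg i)%N)
      c i * (1 - t)^-1 ^+ a i * (- t / (1 - t)) ^+ b i.
Proof.
move=> t1; have t0 : 1 - t != 0 by rewrite subr_eq0 eq_sym.
have := sum1 (x := (1 - t)^-1) (y := - t / (1 - t)).
rewrite (bigID (fun i => deg i <= k)%N) /= => /(_ _)/(canRL (addKr _)) sumE.
rewrite (eq_bigl (fun i => ~~ (deg i <= k)%N)); last by move=> i; rewrite ltnNge.
rewrite sumE; last by field.
rewrite mulrDr mulr1 mulrN addrC /residual !hornerE horner_sum; congr (_ - _).
rewrite mulr_sumr; apply: eq_bigr => i ik; rewrite !hornerE.
rewrite -{2}(subnK ik) /deg !exprD [(- t / _) ^+ _]exprMn [(- t) ^+ _]exprNn !exprVn.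
by rewrite /=; field; rewrite !expf_neq0.
Qed.

Lemma residual_neq0 k i0 : i0 \in r -> (k < deg i0)%N -> residual k != 0.
Proof.
(* At [t = -1] the scaled point is [(1/2, 1/2)], where every remaining term is positive. *)
move=> ri0 ki0; apply/eqP => /(congr1 (horner^~ (-1))) /eqP.
rewrite horner_residual ?horner0; last by rewrite lt_eqF //; lra.
rewrite opprK mulf_eq0 expf_eq0 [1 + 1 == 0]gt_eqF ?andbF /=; last by lra.
have pos i : i \in r ->
    0 < c i * (1 + 1)^-1 ^+ a i * (1 / (1 + 1)) ^+ b i :> R.
  by move=> /c_gt0 ci; rewrite !mulr_gt0 ?exprn_gt0 ?divr_gt0 ?invr_gt0 ?addr_gt0.
rewrite big_seq_cond psumr_eq0; last by move=> i /andP[/pos/ltW].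
by move=> /allP/(_ _ ri0); rewrite ri0 ki0 gt_eqF // pos.
Qed.

Lemma residual_eq0 k : (forall i, i \in r -> deg i <= k)%N -> residual k = 0.
Proof.
move=> rk; apply: (@roots_geq_poly_eq0 _ _
  [seq - (j%:R : R) | j <- iota 0 (size (residual k))]).
- apply/allP => _ /mapP[j _ ->]; rewrite /root horner_residual; last first.
    by rewrite lt_eqF // (@le_lt_trans _ _ 0) // oppr_le0.
  rewrite big_seq_cond big_pred0 ?mulr0 // => i.
  by apply/negP => /andP[/rk]; lia.
- by rewrite map_inj_uniq ?iota_uniq // => i j /oppr_inj/eqP; rewrite eqr_nat => /eqP.
- by rewrite size_map size_iota.
Qed.

Lemma alternates_residual i0 k : i0 \in r -> (k < deg i0)%N ->
  exists e l, [/\ alternates (nth 0 (residual k)) e 0 l, (0 < l)%N &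
                  (k < l + 2 * count (fun i => deg i <= k)%N r)%N].
Proof.
move=> ri0; elim: k => [|k IH] ki0.
  have [e alt] := alternates1 (residual_neq0 ri0 ki0).
  by exists e, 1%N.
have [e [l [alt l0 kl]]] := IH (ltnW ki0).
have [e' alt'] := alternates1 (residual_neq0 ri0 ki0).
set n := count (fun i => deg i == k.+1) r.
have cntS : count (fun i => deg i <= k.+1)%N r
    = (count (fun i => deg i <= k)%N r + n)%N.
  rewrite -count_predUI [X in (_ + X)%N](@eq_count _ _ pred0).
    by rewrite count_pred0 addn0; apply: eq_count => j /=; lia.
  by move=> j /=; lia.
(* If the [n] new monomials may destroy every sign change, restart from length 1: the [2 * n] added
   to the count makes up for the lost [l]. *)
have [le_l|lt_l] := leqP l (2 * n).
  by exists e', 1%N; split=> //; rewrite cntS; lia.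
exists e, (l.+1 - 2 * n)%N; split; [|lia|rewrite cntS; lia].
rewrite residualS; apply: alternates_sub_monomials.
rewrite subnK; last by lia.
exact: alternates_mul1BX.
Qed.

(* This is the bound [d <= 2 N - 3] of D'Angelo, Kos and Riehl. *)
Lemma bivariate_degree_bound i0 :
  i0 \in r -> (0 < a i0 + b i0)%N -> (a i0 + b i0 + 3 <= 2 * size r)%N.
Proof.
move=> ri0 d0.
have [j rj jmax] : exists2 j, j \in r & forall i, i \in r -> (deg i <= deg j)%N.
  case: r ri0 => // x s _.
  have: \max_(i <- x :: s) deg i \in [seq deg i | i <- x :: s].
    elim: s => [|y s IHs] in x *; first by rewrite big_seq1 mem_head.
    rewrite big_cons /maxn; case: ltnP => _; last exact: mem_head.
    by rewrite /= in_cons IHs orbT.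
  by move=> /mapP[j sj mj]; exists j => // i si; rewrite -mj leq_bigmax_seq.
apply: (@leq_trans (deg j + 3)); first by rewrite leq_add2r jmax.
case dj: (deg j) => [|k]; first by have := jmax _ ri0; rewrite dj /deg; lia.
have [|e [l [alt l0 kl]]] := @alternates_residual j k rj; first by rewrite dj.
(* At the top degree the residual vanishes, so [(1 - 'X) * residual k] is just the sum of the top
   monomials. *)
have /eqP := residual_eq0 jmax; rewrite dj residualS subr_eq0 => /eqP top.
have := alternates_mul1BX l0 alt; rewrite top => {}alt.
have cnt : (l < count (fun i => deg i == k.+1) r)%N.
  rewrite -size_filter -(size_map b); apply: leq_trans (count_size (leq 0) _).
  apply: alternates_count alt => m; apply: contraR => mb.
  rewrite coef_sum big_seq_cond big1 // => i /andP[ri di].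
  rewrite coefZ coefXn; case: eqP => [mi|]; last by rewrite mulr0.
  by case/negP: mb; rewrite mi map_f // mem_filter di ri.
have cntC : (count (fun i => deg i == k.+1) r
    <= count (predC (fun i => deg i <= k)%N) r)%N.
  by apply: sub_count => i /=; lia.
rewrite -(count_predC (fun i => deg i <= k)%N r).
move: kl cnt cntC; set s := count _ r; set t := count _ r; set u := count _ r.
lia.
Qed.

End Bivariate.

(** * Substituting bivariate monomials for the variables *)

Lemma substitution_degree_bound (R : realFieldType) n (p : {mpoly R[n]})
    (C : 'I_n -> R) (A B : 'I_n -> nat) (m : 'X_{1..n}) :
  (forall m', 0 <= p@_m') ->
  (forall x : 'I_n -> R, \sum_i x i = 1 -> p.@[x] = 1) ->
  (forall i, 0 < C i) ->
  (forall x y : R, x + y = 1 -> \sum_i C i * x ^+ A i * y ^+ B i = 1) ->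
  m \in msupp p -> (0 < \sum_i (A i + B i) * m i)%N ->
  (\sum_i (A i + B i) * m i + 3 <= 2 * size (msupp p))%N.
Proof.
move=> p0 p1 C0 CAB mp.
have -> : (\sum_i (A i + B i) * m i = \sum_i A i * m i + \sum_i B i * m i)%N.
  by rewrite -big_split; apply: eq_bigr => i _; rewrite mulnDl.
(* Terms stay indexed by [msupp p], so monomials that coincide after substitution need not be
   merged. *)
apply: (@bivariate_degree_bound _ _ _ (fun m' => p@_m' * \prod_i C i ^+ m' i)
  (fun m' => \sum_i A i * m' i)%N (fun m' => \sum_i B i * m' i)%N) => //.
  move=> m' m'p; rewrite mulr_gt0 //.
    by rewrite lt_def p0 andbT -mcoeff_msupp.
  by apply: prodr_gt0 => i _; rewrite exprn_gt0.
move=> x y /CAB/p1; rewrite mevalE => {2}<-; apply: eq_bigr => m' _.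
rewrite !expr_sum -!mulrA -!big_split; congr (_ * _); apply: eq_bigr => i _ /=.
by rewrite !exprM !exprMn mulrA.
Qed.

(** * Lucas polynomials and the sharp bivariate polynomial *)

(* Coefficients of the Lucas polynomials [L_0 = 2], [L_1 = x],
   [L_(m+2) = x L_(m+1) + y L_m]. *)
Fixpoint lucas m s : nat :=
  match m with
  | 0 => if s is 0 then 2 else 0
  | 1 => if s is 0 then 1 else 0
  | (m'.+1 as m1).+1 => lucas m1 s + if s is s'.+1 then lucas m' s' else 0
  end%N.

Lemma lucasSS m s :
  lucas m.+2 s = (lucas m.+1 s + if s is s'.+1 then lucas m s' else 0)%N.
Proof. by []. Qed.

Lemma lucas_gt0 m s : (s.*2 <= m)%N -> (0 < lucas m s)%N.
Proof.
elim/ltn_ind: m s => -[|[|m]] IH s; [by case: s|by case: s|rewrite lucasSS => sm].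
have [s1|s1] := leqP s.*2 m.+1; first by rewrite addn_gt0 IH.
case: s => [|s] in sm s1 *; first by [].
by rewrite addn_gt0 [X in _ || X]IH ?orbT //; lia.
Qed.

Lemma lucas_eq0 m s : (m < s.*2)%N -> lucas m s = 0%N.
Proof.
elim/ltn_ind: m s => -[|[|m]] IH s; [by case: s|by case: s|rewrite lucasSS => sm].
by rewrite IH //; case: s sm => // s sm; [rewrite IH; lia|lia].
Qed.

(* On [x + y = 1] the roots of [z^2 = x z + y] are [1] and [- y]. *)
Lemma sum_lucas (R : comNzRingType) (x y : R) m k : x + y = 1 -> (m < k.*2)%N ->
  \sum_(s < k) (lucas m s)%:R * x ^+ (m - s.*2) * y ^+ s = 1 + (- y) ^+ m.
Proof.
move=> xy; have {xy} -> : x = 1 - y by rewrite -xy addrK.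
elim/ltn_ind: m k => -[|[|m]] IH [|k] mk; try lia.
- rewrite big_ord_recl big1 => [|i _]; last by rewrite !mul0r.
  by rewrite /= !expr0 !mulr1 addr0.
- rewrite big_ord_recl big1 => [|i _]; last by rewrite !mul0r.
  by rewrite /= expr0 !expr1 mul1r mulr1 addr0.
transitivity ((1 - y) * (\sum_(s < k.+1)
      (lucas m.+1 s)%:R * (1 - y) ^+ (m.+1 - s.*2) * y ^+ s)
    + y * \sum_(s < k) (lucas m s)%:R * (1 - y) ^+ (m - s.*2) * y ^+ s).
  transitivity (\sum_(s < k.+1)
      (lucas m.+1 s)%:R * (1 - y) ^+ (m.+2 - s.*2) * y ^+ s
    + \sum_(s < k.+1) (if s : nat is s'.+1 then lucas m s' else 0)%:R
       * (1 - y) ^+ (m.+2 - s.*2) * y ^+ s).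
    by rewrite -big_split; apply: eq_bigr => s _; rewrite lucasSS natrD !mulrDl.
  congr (_ + _).
    (* Where truncated subtraction would break the exponent identity, the Lucas coefficient is 0. *)
    rewrite mulr_sumr; apply: eq_bigr => s _; have [sm|sm] := leqP s.*2 m.+1.
      by rewrite subSn // exprS; ring.
    by rewrite lucas_eq0 // !mul0r mulr0.
  rewrite big_ord_recl !mul0r add0r mulr_sumr; apply: eq_bigr => s _.
  by rewrite /= /bump /= add1n doubleS !subSS exprS; ring.
by rewrite !IH; try lia; rewrite !exprS; ring.
Qed.

(* The [r + 2] monomials of the sharp polynomial of degree [2 r + 1] in two
   variables: [coef * x ^ degx * y ^ degy] with [i <= r] from the Lucas
   polynomial, and [y ^ (2 r + 1)] for [i = r + 1]. *)
Section SharpPolynomial.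
Variable r : nat.

Definition sharp_coef i := if (i == r.+1)%N then 1%N else lucas r.*2.+1 i.
Definition sharp_degx i := if (i == r.+1)%N then 0%N else (r.*2.+1 - i.*2)%N.
Definition sharp_degy i := if (i == r.+1)%N then r.*2.+1 else i.

Lemma sharp_coef_gt0 i : (i < r.+2)%N -> (0 < sharp_coef i)%N.
Proof.
by rewrite /sharp_coef; case: eqP => // ir ?; apply: lucas_gt0; lia.
Qed.

Lemma sum_sharp (R : comNzRingType) (x y : R) : x + y = 1 ->
  \sum_(i < r.+2) (sharp_coef i)%:R * x ^+ sharp_degx i * y ^+ sharp_degy i = 1.
Proof.
move=> xy; rewrite big_ord_recr /= /sharp_coef /sharp_degx /sharp_degy eqxx.
under eq_bigr => i _ do rewrite [(i : nat) == r.+1]ltn_eqF //.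
rewrite sum_lucas //.
(* The exponent is odd, so the extra monomial cancels [(- y) ^+ r.*2.+1]. *)
by rewrite expr0 !mul1r exprNn -signr_odd /= odd_double expr1 mulN1r subrK.
Qed.

Lemma sum_sharp_deg :
  (2 * \sum_(i < r.+2) (sharp_degx i + sharp_degy i) + 3 * r.+2 + 2
   = 3 * r.+2 ^ 2)%N.
Proof.
have sumE k M : (k <= M.+1)%N ->
    (2 * \sum_(i < k) (M - i) + k * k = k * (M.*2.+1))%N.
  elim: k => [|k IH] kM; first by rewrite big_ord0.
  rewrite big_ord_recr /= mulnDr; have := IH (ltnW kM).
  move: (\sum_(i < k) _)%N => S.
  have [D ->] : exists D, M = (k + D)%N by exists (M - k)%N; lia.
  nia.
rewrite big_ord_recr /= /sharp_degx /sharp_degy eqxx.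
rewrite (eq_bigr (fun i : 'I_r.+1 => r.*2.+1 - i)%N) => [|i _]; last first.
  by rewrite ltn_eqF //=; have := ltn_ord i; lia.
have /sumE : (r.+1 <= r.*2.+2)%N by lia.
by rewrite -mulnn; move: (\sum_(i < r.+1) _)%N => S; nia.
Qed.

Lemma sharp_deg_gt0 i : (i < r.+2)%N -> (0 < sharp_degx i + sharp_degy i)%N.
Proof. by rewrite /sharp_degx /sharp_degy; case: eqP; lia. Qed.

End SharpPolynomial.

(** * Averaging over cyclic shifts, and the final inequalities *)

Lemma degree_bound_nat (R : realFieldType) r d (p : {mpoly R[r.+2]}) :
  (0 < d)%N -> msize p = d.+1 -> (forall m, 0 <= p@_m) ->
  (forall x : 'I_r.+2 -> R, \sum_i x i = 1 -> p.@[x] = 1) ->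
  (d * (\sum_(i < r.+2) (sharp_degx r i + sharp_degy r i)) + 3 * r.+2
    <= 2 * size (msupp p) * r.+2)%N.
Proof.
move=> d0 pd p0 p1.
pose C (i : 'I_r.+2) : R := (sharp_coef r i)%:R.
pose A (i : 'I_r.+2) := sharp_degx r i; pose B (i : 'I_r.+2) := sharp_degy r i.
pose w i := (A i + B i)%N.
have pn0 : p != 0 by rewrite -msize_poly_eq0 pd.
have := mlead_deg pn0; rewrite pd => -[md].
(* The sum [i + j] is taken modulo [r.+2], so over all [j] each exponent of the leading monomial
   meets every weight once. *)
have bound (j : 'I_r.+2) :
    (\sum_(i < r.+2) w (i + j)%R * mlead p i + 3 <= 2 * size (msupp p))%N.
  apply: (@substitution_degree_bound _ _ p (fun i => C (i + j)%R)
    (fun i => A (i + j)%R) (fun i => B (i + j)%R)) => //.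
  - by move=> i; rewrite ltr0n sharp_coef_gt0.
  - by move=> x y /(sum_sharp r) <-; rewrite [RHS](reindex_inj (addIr j)).
  - exact: mlead_supp.
  - apply: (@leq_trans (\sum_i mlead p i)); first by rewrite -mdegE md.
    by apply: leq_sum => i _; rewrite leq_pmull // sharp_deg_gt0.
have : (\sum_(j < r.+2) (\sum_(i < r.+2) w (i + j)%R * mlead p i + 3)
    <= \sum_(j < r.+2) 2 * size (msupp p))%N by apply: leq_sum.
rewrite big_split /= !sum_nat_const card_ord exchange_big /=.
rewrite (eq_bigr (fun i => (\sum_j w j) * mlead p i)%N) => [|i _]; last first.
  by rewrite -big_distrl /= [in RHS](reindex_inj (addrI i)).
rewrite -big_distrr /= -mdegE md /w.
by rewrite mulnC [(r.+2 * 3)%N]mulnC [leqRHS]mulnC.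
Qed.

Theorem theorem1 (R : realType) (n d : nat) (p : {mpoly R[n]}) :
  (2 <= n)%N -> (1 <= d)%N -> inH d p ->
  (d%:R : R) <= (2 * n%:R * (2 * (Nmon p)%:R - 3)) / (3 * n%:R ^+ 2 - 3 * n%:R - 2)
  /\ ((2 * n%:R : R) * (2 * (Nmon p)%:R - 3)) / (3 * n%:R ^+ 2 - 3 * n%:R - 2)
     <= (4 / 3 : R) * ((2 * (Nmon p)%:R - 3) / (2 * n%:R - 3)).
Proof.
case: n p => [|[|r]] p // _ d1 [pd p0 p1].
have bound := degree_bound_nat d1 pd p0 p1.
have wE := sum_sharp_deg r; rewrite /Nmon.
set W := (\sum_(i < _) _)%N in bound wE; set N := size _ in bound *.
have N2 : (3 <= 2 * N)%N by nia.
have {wE} wE : 2 * W%:R = 3 * r.+2%:R ^+ 2 - 3 * r.+2%:R - 2 :> R.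
  move/(congr1 (fun k => k%:R : R)): wE; rewrite !natrD !natrM expr2; lra.
rewrite -wE.
have {}bound : d%:R * W%:R + 3 * r.+2%:R <= 2 * N%:R * r.+2%:R :> R.
  by rewrite -!natrM -natrD ler_nat.
have {}N2 : 3 <= 2 * N%:R :> R by rewrite -natrM ler_nat.
have n2 : 2 <= r.+2%:R :> R by rewrite ler_nat.
move: (r.+2%:R) n2 wE bound => n n2 wE bound.
have W0 : 0 < 2 * W%:R :> R by rewrite wE; nra.
split; first by rewrite ler_pdivlMr //; lra.
have n0 : 0 < 2 * n - 3 by lra.
rewrite mulrA ler_pdivrMr // [leRHS]mulrAC ler_pdivlMr // wE -subr_ge0.
(* With denominators cleared, the difference of the two sides factors, and [n >= 2] makes
   [2 * n - 8 / 3] positive. *)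
have -> : 4 / 3 * (2 * N%:R - 3) * (3 * n ^+ 2 - 3 * n - 2)
    - 2 * n * (2 * N%:R - 3) * (2 * n - 3)
    = (2 * N%:R - 3) * (2 * n - 8 / 3) by field.
by rewrite mulr_ge0 //; lra.
Qed.
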